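(* There exist random probability measures $\mu,\nu$ a.s. supported in $\{1,2,4,8\}$ such that for every integer $k\ge0$ the random moments $\mu_k=\int_{\mathbb{R}}x^k\,d\mu(x)$ and $\nu_k=\int_{\mathbb{R}}x^k\,d\nu(x)$ have the same distribution, but $\mu$ and $\nu$ do not have the same distribution.
   Context: A random probability measure is a random variable with values in the set $P(\mathbb{R})$ of Borel probability measures on $\mathbb{R}$, equipped with the $\sigma$-algebra generated by the maps $\mu\mapsto\mu(B)$, $B\subset\mathbb{R}$ Borel. *)

(* Defs.v *)
From HB Require Import structures.
From mathcomp Require Import all_boot all_order all_algebra.
From mathcomp Require Import all_classical all_reals all_analysis.
From mathcomp Require Import measurable_realfun.

Set Implicit Arguments.
Unset Strict Implicit.
Unset Printing Implicit Defensive.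

Import Order.TTheory GRing.Theory Num.Theory.
Import numFieldNormedType.Exports.

Local Open Scope classical_set_scope.
Local Open Scope ring_scope.

(* The sigma-algebra of [pprobability] is generated by the sets
   [set mu | mu U < r%:E] with U measurable and r in [0, 1]; since mu U lies
   in [0, 1], it is the one generated by the evaluations mu |-> mu U. *)
Definition random_measure d (Omega : measurableType d) (R : realType)
    (P : probability Omega R) :=
  {RV P >-> pprobability R R}.

(* A total function: the value is 0 when 'X^k has an infinite or undefined
   integral, which cannot happen for a measure with finite support. *)
Definition moment (R : realType) (k : nat) (mu : pprobability R R) : R :=
  \int[mu]_x (x ^+ k).

Lemma measurable_moment (R : realType) (k : nat) :
  measurable_fun [set: pprobability R R] (@moment R k).
Proof.
have mev U : measurable U ->
    measurable_fun [set: pprobability R R] (fun mu : pprobability R R => mu U).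
  move=> mU.
  have mid : measurable_fun [set: pprobability R R] (@idfun (pprobability R R)).
    exact: measurable_id.
  exact: (measurable_kernel (kprobability mid)).
have mX : measurable_fun [set: R] (fun x : R => (x ^+ k)%:E).
  by apply/measurable_EFinP; exact: exprn_measurable.
apply: measurableT_comp => //=.
rewrite (_ : (fun _ => _) = (fun mu : pprobability R R =>
    (\int[mu]_x ((fun x : R => (x ^+ k)%:E)^\+ x)
     - \int[mu]_x ((fun x : R => (x ^+ k)%:E)^\- x))%E)); last first.
  by apply/funext => mu; rewrite integralE.
apply: emeasurable_funB.
- apply: (measurable_fun_integral_kernel (l := fun mu : pprobability R R => mu)).
  + exact: mev.
  + by move=> z; exact: funepos_ge0.
  + exact: measurable_funepos.
- apply: (measurable_fun_integral_kernel (l := fun mu : pprobability R R => mu)).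
  + exact: mev.
  + by move=> z; exact: funeneg_ge0.
  + exact: measurable_funeneg.
Qed.

HB.instance Definition _ (R : realType) (k : nat) :=
  isMeasurableFun.Build _ _ _ _ (@moment R k) (@measurable_moment R k).

Definition random_moment d (Omega : measurableType d) (R : realType)
    (P : probability Omega R) (X : random_measure P) (k : nat) : {RV P >-> R} :=
  @moment R k \o X.

(* Laws are compared on measurable sets only: [distribution P X] is a function
   on all sets, and its values on nonmeasurable ones carry no meaning. *)
Definition same_distribution d (Omega : measurableType d) (R : realType)
    (P : probability Omega R) d' (T : measurableType d')
    (X Y : {RV P >-> T}) : Prop :=
  forall A : set T, measurable A -> distribution P X A = distribution P Y A.

Definition as_supported_in d (Omega : measurableType d) (R : realType)
    (P : probability Omega R) (X : random_measure P) (S : set R) : Prop :=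
  {ae P, forall w, X w S = 1%E}.

Arguments same_distribution {d Omega R} P {d' T} X Y.
Arguments as_supported_in {d Omega R} P X S.

(* Main.v *)
From HB Require Import structures.
Require Import Defs.
From mathcomp Require Import all_boot all_order all_algebra.
From mathcomp Require Import all_classical all_reals all_analysis.
From mathcomp Require Import measurable_realfun ring lra.

(* For a bounded vector (x0, x1, x2), tilt the weights of the uniform
   probability on {1, 2, 4, 8} by 1/16 of (- A, A - B, B - C, C), where
   (A, B, C) = (x0 + x1, 2 x2, x0 - x1).  With t = 2^k, the k-th moment is then
   an affine function of
     (t - 1) (A + B t + C t^2) = (t - 1) (1 + t^2) (x0 + x1 cos a + x2 sin a),
   a = 2 atan t: moments only see (x0, x1, x2) along directions of the light
   cone.  Along those, the uniform law on the circle of the points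
   (0, cos p, - sin p), giving cos (p + a), cannot be told from the law of
   (cos p, 0, 0), giving cos p.  These two laws define mu and nu; they differ
   because the mass of {4, 8} is 1/2 + B/16, and B vanishes a.s. for nu only. *)

Set Implicit Arguments.
Unset Strict Implicit.
Unset Printing Implicit Defensive.

Import Order.TTheory GRing.Theory Num.Theory.
Import numFieldNormedType.Exports.

Local Open Scope classical_set_scope.
Local Open Scope ring_scope.

(** * Translation invariance of Lebesgue measure and of the uniform law on a period *)

Lemma lebesgue_measure_shift (R : realType) (c : R) (A : set R) :
  measurable A ->
  lebesgue_measure ((fun x => x + c) @^-1` A) = lebesgue_measure A.
Proof.
pose f (x : R) : measurableTypeR R := x + c.
have mf : measurable_fun setT f by exact: measurable_funD.
move=> mA; rewrite -[LHS]/(pushforward lebesgue_measure f A).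
(* Lebesgue measure is determined by its values on the intervals []a, b]], so the pushforward is
   only compared there. *)
apply/esym/lebesgue_measure_unique => //= _ [[a b]] _ <-.
rewrite /pushforward (_ : _ @^-1` _ = `](a - c), (b - c)]%classic); last first.
  by apply/seteqP; split=> x /=; rewrite !in_itv/= ltrBlDr lerBrDr.
by rewrite !lebesgue_measure_itv/= !lte_fin ltrD2r -!EFinB opprB addrA subrK.
Qed.

(* The part of [`[a, a + T[] beyond [T] is moved back by [T]. *)
Lemma lebesgue_measure_periodic (R : realType) (T a : R) (E : set R) :
  measurable E -> (forall x, E (x + T) <-> E x) -> 0 <= a <= T ->
  lebesgue_measure (E `&` `[a, a + T[) = lebesgue_measure (E `&` `[0, T[).
Proof.
move=> mE perE /andP[a0 aT].
have mEI (i : interval R) : measurable (E `&` [set` i]) by exact: measurableI.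
have cut (x y z : R) : x <= y -> y <= z ->
    lebesgue_measure (E `&` `[x, z[) =
    (lebesgue_measure (E `&` `[x, y[) + lebesgue_measure (E `&` `[y, z[))%E.
  move=> xy yz; rewrite -measureU; [|exact: mEI|exact: mEI|]; last first.
    apply/seteqP; split=> // w /= [[_]]; rewrite !in_itv/= => /andP[_ wy] [_].
    by rewrite leNgt wy.
  by rewrite -setIUr -itv_bndbnd_setU ?bnd_simp.
rewrite (cut a T (a + T)) ?lerDr// (cut 0 a T)// addeC; congr +%E.
rewrite -(@lebesgue_measure_shift _ T (_ `&` `[T, a + T[))//.
congr (lebesgue_measure _).
apply/seteqP; split=> x /=; rewrite !in_itv/= => -[Ex xa].
  by split; [exact/perE|move: xa; rewrite lerDr ltrD2r].
by split; [exact/perE|rewrite lerDr ltrD2r].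
Qed.

(** The density lives on the closed interval; dropping the null endpoint [b] gives half-open
    intervals, which tile the line by periods. *)
Lemma uniform_probE (R : realType) (a b : R) (ab : a < b) (E : set R) :
  measurable E ->
  uniform_prob ab E = ((b - a)^-1%:E * lebesgue_measure (E `&` `[a, b[))%E.
Proof.
move=> mE; rewrite /uniform_prob integral_uniform_pdf.
rewrite (eq_integral (cst (b - a)^-1%:E)); last first.
  by move=> x /set_mem[_]; rewrite /= in_itv/= /uniform_pdf => ->.
rewrite integral_cst//; last exact: measurableI.
congr *%E; rewrite -(setUitv1 true)//= ?bnd_simp ?(ltW ab)// setIUr measureU0//.
- exact: measurableI.
- exact: measurableI.
- by apply/eqP; rewrite -measure_le0 -(lebesgue_measure_set1 b) measureIr.
Qed.

(** The shift carries the preimage within [[0, T[] onto the part of [E] in [[a, a + T[], again a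
    full period. *)
Lemma uniform_prob_periodic (R : realType) (T a : R) (T0 : 0 < T) (E : set R) :
  measurable E -> (forall x, E (x + T) <-> E x) -> 0 <= a <= T ->
  uniform_prob T0 ((fun x => x + a) @^-1` E) = uniform_prob T0 E.
Proof.
move=> mE perE aT.
have mEa : measurable ((fun x => x + a) @^-1` E).
  rewrite -[X in measurable X]setTI.
  have mD : measurable_fun [set: R] (fun x => x + a) by exact: measurable_funD.
  exact: mD.
rewrite !uniform_probE//; congr *%E.
rewrite -(lebesgue_measure_periodic mE perE aT).
rewrite -[RHS](lebesgue_measure_shift a); last exact: measurableI.
by congr (lebesgue_measure _); apply/seteqP; split=> x /=;
  rewrite !in_itv/= lerDr addrC ltrD2l addrC.
Qed.

(** * Random measures with fixed atoms and random weights *)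

Section atomic.
Context (R : realType) (n : nat) (a : nat -> R).

Definition atomic_measure (w : nat -> {nonneg R}) : set R -> \bar R :=
  msum (fun i => mscale (w i) \d_(a i)) n.

HB.instance Definition _ w := Measure.on (atomic_measure w).

Lemma atomic_measureE w (A : set R) :
  atomic_measure w A = (\sum_(i < n) (w i)%:num * \1_A (a i))%:E.
Proof. by rewrite /atomic_measure/= /msum -sumEFin. Qed.

(** The rules for sums and scalings of measures apply to nonnegative integrands, so [f] is split
    into its positive and negative parts. *)
Lemma integral_atomic_measure w (f : R -> R) : measurable_fun setT f ->
  (\int[atomic_measure w]_x (f x)%:E =
   (\sum_(i < n) (w i)%:num * f (a i))%:E)%E.
Proof.
move=> mf.
have ge0_integral (g : R -> R) :
    measurable_fun setT g -> (forall x, 0 <= g x) ->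
    (\int[atomic_measure w]_x (g x)%:E =
     (\sum_(i < n) (w i)%:num * g (a i))%:E)%E.
  move=> mg g0.
  have mEg : measurable_fun setT (EFin \o g) by exact/measurable_EFinP.
  rewrite ge0_integral_measure_sum//; last by move=> x _; rewrite lee_fin.
  rewrite -sumEFin; apply: eq_bigr => i _.
  rewrite ge0_integral_mscale//; last by move=> x _; rewrite lee_fin.
  by rewrite integral_dirac//= diracT mul1e.
rewrite integralE.
under eq_integral do rewrite funeposE -EFin_max.
under [in X in (_ - X)%E]eq_integral do rewrite funenegE -EFinN -EFin_max.
rewrite !ge0_integral.
- rewrite -EFinB -sumrB; congr EFin; apply: eq_bigr => i _.
  rewrite -mulrBr; congr (_ * _); rewrite /Num.max oppr_lt0.
  by case: ltgtP => [f0|f0|->]; rewrite ?subr0 ?sub0r ?opprK ?oppr0.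
- by apply: measurable_maxr => //; exact: measurable_funN.
- by move=> x; rewrite le_max lexx orbT.
- exact: measurable_maxr.
- by move=> x; rewrite le_max lexx orbT.
Qed.

(** The normalization is an argument so that the probability instance below can be attached to this
    name. *)
Definition atomic_prob (w : nat -> {nonneg R}) of
  \sum_(i < n) (w i)%:num = 1 := atomic_measure w.

HB.instance Definition _ w w1 := Measure.on (@atomic_prob w w1).

Let atomic_prob_setT w w1 : @atomic_prob w w1 setT = 1%E.
Proof.
rewrite /atomic_prob atomic_measureE -w1; congr EFin.
by apply: eq_bigr => i _; rewrite indicT mulr1.
Qed.

HB.instance Definition _ w w1 :=
  @Measure_isProbability.Build _ _ R (@atomic_prob w w1) (atomic_prob_setT w1).

Lemma random_measure_atomic d (Omega : measurableType d)
    (P : probability Omega R) (w : nat -> Omega -> R) :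
  (forall i, measurable_fun setT (w i)) -> (forall i x, 0 <= w i x) ->
  (forall x, \sum_(i < n) w i x = 1) ->
  exists X : random_measure P,
    (forall x A, X x A = (\sum_(i < n) w i x * \1_A (a i))%:E) /\
    (forall x k, moment k (X x) = \sum_(i < n) w i x * a i ^+ k).
Proof.
move=> mw w0 w1.
pose X x : pprobability R R := @atomic_prob (fun i => NngNum (w0 i x)) (w1 x).
have mX : measurable_fun setT X.
  (* It suffices to test the generators [mu U < r], and here the mass of [U] is a finite sum of
     measurable weights. *)
  apply: (measurability (@pset _ _ _ : set (set (pprobability _ R)))) => //.
  move=> _ -[_ [r r01] [U mU <-]] <-; apply: emeasurable_fun_infty_o => //=.
  under [X in measurable_fun _ X]eq_fun do
    rewrite /X /= /atomic_prob atomic_measureE.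
  apply/measurable_EFinP; apply: measurable_sum => i.
  exact: (measurable_funM (mw i) (measurable_cst _)).
exists (mfun_Sub (mem_set mX)); split=> [x A|x k] /=.
  by rewrite /X/= /atomic_prob atomic_measureE.
rewrite /moment /Rintegral /=.
by rewrite (integral_atomic_measure _ (@exprn_measurable _ _ k)).
Qed.

End atomic.

(** * Tilted weights, their moments and the half-angle formula *)

Section tilt.
Context (R : realType).
Implicit Types A B C : R.

Definition tilt A B C (i : nat) : R :=
  4^-1 + 16^-1 * [:: - A; A - B; B - C; C]`_i.

(** Each correction is at most 3 in absolute value, and 1/4 - 3/16 > 0. For [i >= 4] the default
    entry 0 leaves the weight 1/4. *)
Lemma tilt_ge0 A B C i : `|A| <= 1 -> `|B| <= 2 -> `|C| <= 1 ->
  0 <= tilt A B C i.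
Proof.
rewrite !ler_norml /tilt => /andP[? ?] /andP[? ?] /andP[? ?].
by case: i => [|[|[|[|i]]]] /=; rewrite ?nth_nil; lra.
Qed.

Lemma sum_tilt A B C : \sum_(i < 4) tilt A B C i = 1.
Proof. by rewrite !big_ord_recl big_ord0 /tilt/=; field. Qed.

(** Summation by parts: - A + (A - B) t + (B - C) t^2 + C t^3 is divisible by t - 1. *)
Lemma tilt_moment A B C k : let t := 2 ^+ k in
  \sum_(i < 4) tilt A B C i * (2 ^+ i) ^+ k =
  4^-1 * (1 + t + t ^+ 2 + t ^+ 3) +
  16^-1 * (t - 1) * (A + B * t + C * t ^+ 2).
Proof.
move=> t; under eq_bigr do rewrite exprAC.
by rewrite !big_ord_recl big_ord0 /tilt/= -/t !expr0 /bump/=; field.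
Qed.

Lemma measurable_tilt d (Omega : measurableType d) (A B C : Omega -> R) i :
  measurable_fun setT A -> measurable_fun setT B -> measurable_fun setT C ->
  measurable_fun setT (fun x => tilt (A x) (B x) (C x) i).
Proof.
move=> mA mB mC; apply: measurable_funD => //; apply: measurable_funM => //.
case: i => [|[|[|[|[|i]]]]] //=.
- exact: measurable_funN.
- exact: measurable_funB.
- exact: measurable_funB.
Qed.

End tilt.

(** With a = 2 atan t, this is the addition formula for cos (x + a) with cos a = (1 - t^2) / (1 +
    t^2) and sin a = 2 t / (1 + t^2), cleared of denominators. *)
Lemma cos_addr_atan2 (R : realType) (x t : R) :
  (1 + t ^+ 2) * cos (x + atan t *+ 2) =
  (1 - t ^+ 2) * cos x - 2 * t * sin x.
Proof.
have c0 : cos (atan t) != 0.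
  by rewrite gt_eqF// cos_gt0_pihalf// atan_gtNpi2 atan_ltpi2.
have s : sin (atan t) = t * cos (atan t) by rewrite -{2}(atanK t) /tan divfK.
have := cos2Dsin2 (atan t); rewrite cosD cos_mulr2n sin_mulr2n s => e.
have e' : (1 + t ^+ 2) * cos (atan t) ^+ 2 = 1 by rewrite -[RHS]e; ring.
transitivity (cos x * (((1 + t ^+ 2) * cos (atan t) ^+ 2) *+ 2 - (1 + t ^+ 2))
   - 2 * t * sin x * ((1 + t ^+ 2) * cos (atan t) ^+ 2)); first by ring.
by rewrite e'; ring.
Qed.

(** * The two random measures: equal laws of each moment, different laws *)

Theorem theorem4p2p1 (R : realType) :
  exists (d : measure_display) (Omega : measurableType d)
         (P : probability Omega R) (mu nu : random_measure P),
    [/\ as_supported_in P mu [set 1; 2; 4; 8],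
        as_supported_in P nu [set 1; 2; 4; 8],
        (forall k : nat,
           same_distribution P (random_moment mu k) (random_moment nu k))
      & ~ same_distribution P mu nu].
Proof.
have T0 : 0 < pi *+ 2 :> R by rewrite mulrn_wgt0// pi_gt0.
have mcos : measurable_fun setT (@cos R).
  by apply: continuous_measurable_fun; exact: continuous_cos.
have msin : measurable_fun setT (@sin R).
  by apply: continuous_measurable_fun; exact: continuous_sin.
pose P : probability _ R := uniform_prob T0.
(* The angle [x] is uniform on a period. The vector (x0, x1, x2) is (0, cos x, - sin x) for [mu] and
   (cos x, 0, 0) for [nu]. *)
pose wmu i (x : R) := tilt (cos x) (- 2 * sin x) (- cos x) i.
pose wnu i (x : R) := tilt (cos x) 0 (cos x) i.
have [mu [muE mu_moment]] : exists mu : random_measure P,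
  (forall x A, mu x A = (\sum_(i < 4) wmu i x * \1_A (2 ^+ i))%:E) /\
    (forall x k, moment k (mu x) = \sum_(i < 4) wmu i x * (2 ^+ i) ^+ k).
  apply: random_measure_atomic => [i|i x|x]; last exact: sum_tilt.
    apply: measurable_tilt => //; first exact: measurable_funM.
    exact: measurable_funN.
  apply: tilt_ge0; rewrite ?normrN ?cos_max//.
  by rewrite normrM normrN (@ger0_norm _ 2)// ler_piMr// sin_max.
have [nu [nuE nu_moment]] : exists nu : random_measure P,
  (forall x A, nu x A = (\sum_(i < 4) wnu i x * \1_A (2 ^+ i))%:E) /\
    (forall x k, moment k (nu x) = \sum_(i < 4) wnu i x * (2 ^+ i) ^+ k).
  apply: random_measure_atomic => [i|i x|x]; last exact: sum_tilt.
    exact: measurable_tilt.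
  by apply: tilt_ge0; rewrite ?normr0 ?cos_max.
have in_supp (i : 'I_4) : \1_[set 1; 2; 4; 8] (2 ^+ i : R) = 1 :> R.
  rewrite indicE mem_set//=; case: i => -[|[|[|[|//]]]] _ /=.
  - by left; left; left.
  - by left; left; right.
  - by left; right; rewrite -natrX.
  - by right; rewrite -natrX.
exists _, _, P, mu, nu; split.
- apply: aeW => x; rewrite muE; congr EFin.
  by under eq_bigr do rewrite in_supp mulr1; exact: sum_tilt.
- apply: aeW => x; rewrite nuE; congr EFin.
  by under eq_bigr do rewrite in_supp mulr1; exact: sum_tilt.
- move=> k A mA; rewrite /distribution /pushforward /random_moment.
  pose t : R := 2 ^+ k.
  (* The same affine [F] serves both: the moment is [F (cos x)] for [nu] and
     [F (cos (x + atan t *+ 2))] for [mu], so the two events differ by a shift of the angle. *)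
  pose F (y : R) := 4^-1 * (1 + t + t ^+ 2 + t ^+ 3) +
    16^-1 * (t - 1) * ((1 + t ^+ 2) * y).
  have t0 : 0 <= t by exact: exprn_ge0.
  pose E := (F \o cos) @^-1` A.
  transitivity (P ((fun x => x + atan t *+ 2) @^-1` E)).
    congr (P _); apply/seteqP; rewrite /E /preimage /=.
    suff e x : moment k (mu x) = F (cos (x + atan t *+ 2)).
      by split=> x /=; rewrite e.
    rewrite mu_moment tilt_moment /F cos_addr_atan2 -/t; congr (_ + _); ring.
  transitivity (P E); last first.
    congr (P _); apply/seteqP; rewrite /E /preimage /=.
    suff e x : moment k (nu x) = F (cos x) by split=> x /=; rewrite e.
    rewrite nu_moment tilt_moment /F -/t; congr (_ + _); ring.
  apply: uniform_prob_periodic.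
  + rewrite -[X in measurable X]setTI.
    have mF : measurable_fun setT (F \o cos).
      by apply: measurable_funD => //; do 2 apply: measurable_funM => //.
    exact: mF.
  + by move=> x; rewrite /E/= cosD2pi.
  (* As t >= 0, 0 <= atan t < pi / 2 <= pi, so the shift lies within one period. *)
  + rewrite mulrn_wge0 ?lerMn2r/=; last by rewrite -atan0 le_atan.
    rewrite (le_trans (ltW (atan_ltpi2 t)))// ler_pdivrMr// ler_peMr ?pi_ge0//.
    by rewrite ler1n.
pose S : set R := [set 4; 8].
have in_top (i : 'I_4) : \1_S (2 ^+ i : R) = (2 <= i)%:R :> R.
  case: i => -[|[|[|[|//]]]] _ /=.
  - by rewrite /S indicE memNset//= => -[]; lra.
  - by rewrite /S indicE memNset//= => -[]; lra.
  - by rewrite /S indicE mem_set//=; left; rewrite -natrX.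
  - by rewrite /S indicE mem_set//=; right; rewrite -natrX.
have tilt_top A B C : \sum_(i < 4) tilt A B C i * \1_S (2 ^+ i : R) =
    2^-1 + 16^-1 * B :> R.
  under eq_bigr do rewrite in_top.
  by rewrite !big_ord_recl big_ord0 /tilt/= /bump/=; field.
(* The threshold 1/2 is the mass of [S] when B = 0: [nu] never falls strictly below it, while [mu]
   does as soon as sin x > 0. *)
pose light : set (pprobability R R) := mset S 2^-1.
have mlight : measurable light.
  apply: sub_sigma_algebra; exists 2^-1; first by rewrite /= in_itv/=; lra.
  by exists S => //; exact: measurableU.
have nu_light : nu @^-1` light = set0.
  apply/seteqP; split=> x //=.
  by rewrite /light/mset/= nuE tilt_top mulr0 addr0 ltxx.
move=> /(_ _ mlight).
rewrite /distribution /pushforward nu_light measure0 => mu0.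
(* Equal laws would make []0, pi[], where sin is positive, a null set, yet it is half of the
   period. *)
have : (P [set` `]0%R, pi[] <= 0)%E.
  rewrite -mu0//; apply: le_measure; rewrite ?inE//.
    by rewrite -[X in measurable X]setTI; exact: measurable_funPT.
  move=> x /=; rewrite in_itv/= => /sin_gt0_pi sx.
  suff : (mu x S < (2^-1)%:E)%E by [].
  by rewrite muE tilt_top lte_fin; lra.
have -> : P [set` `]0%R, pi[] = ((pi *+ 2 - 0)^-1%:E *
    lebesgue_measure (`]0%R, pi[ `&` `[0%R, (pi *+ 2)%R[))%E.
  by apply: uniform_probE; exact: measurable_itv.
rewrite setIidl; last first.
  move=> x /=; rewrite !in_itv/= => /andP[x0 xpi].
  by rewrite (ltW x0) (lt_trans xpi)// mulr2n ltrDl pi_gt0.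
rewrite lebesgue_measure_itv/= lte_fin pi_gt0 subr0 sube0 -EFinM lee_fin leNgt.
by rewrite mulr_gt0 ?pi_gt0// invr_gt0.
Qed.
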